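(* Let $\mathbf{K}$ be a full subcategory of the category $\mathbf{Top_0}$ of $T_0$ spaces and continuous mappings such that $\mathbf{K}\nsubseteq\mathbf{Top_1}$ (i.e. some object of $\mathbf{K}$ is not a $T_1$ space), and suppose that $\mathbf{K}$ is closed under homeomorphism (if $X\in\mathbf{K}$ and $Y$ is homeomorphic to $X$, then $Y\in\mathbf{K}$). Then the following four statements are equivalent: (1) $\mathbf{K}$ is reflective in $\mathbf{Top_0}$; (2) $\mathbf{K}$ satisfies all of the conditions (K1)--(K4): (K1) $\mathbf{K}$ contains all sober spaces; (K2) if $X\in\mathbf{K}$ and $Y$ is homeomorphic to $X$, then $Y\in\mathbf{K}$; (K3) if $\{X_i:i\in I\}\subseteq\mathbf{K}$ is a family of subspaces of a sober space, then the subspace $\bigcap_{i\in I}X_i$ belongs to $\mathbf{K}$; (K4) if $f:X\to Y$ is a continuous mapping from a sober space $X$ to a sober space $Y$, then for any subspace $Y_1$ of $Y$, $Y_1\in\mathbf{K}$ implies that the subspace $f^{-1}(Y_1)$ of $X$ belongs to $\mathbf{K}$; (3) $\mathbf{K}$ is productive and $b$-closed-hereditary; (4) $\mathbf{K}$ is productive and has equalizers.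
   Context: $\mathbf{Top_0}$ (resp. $\mathbf{Top_1}$) is the category of all $T_0$ (resp. $T_1$) spaces with continuous mappings. A nonempty subset $A$ of a $T_0$ space is irreducible if for any closed sets $F_1,F_2$, $A\subseteq F_1\cup F_2$ implies $A\subseteq F_1$ or $A\subseteq F_2$. A $T_0$ space $X$ is sober if every irreducible closed set is the closure $\mathrm{cl}(\{x\})$ of a (unique) point $x\in X$. The $b$-topology on a $T_0$ space $X$ is the topology with base $\{U\cap \mathrm{cl}(\{x\}): x\in U,\ U \text{ open in } X\}$; a subset is $b$-closed if it is closed in the $b$-topology. A subcategory $\mathbf{K}$ of $\mathbf{Top_0}$ is: - reflective, if for each $X\in\mathbf{Top_0}$ there are $X^k\in\mathbf{K}$ and a continuous mapping $\mu_X:X\to X^k$ such that for every continuous mapping $f:X\to Z$ with $Z\in\mathbf{K}$ there is a unique continuous mapping $g:X^k\to Z$ with $g\circ\mu_X=f$; - productive, if the topological product $\prod_{i\in I}X_i\in\mathbf{K}$ whenever $\{X_i:i\in I\}\subseteq\mathbf{K}$; - $b$-closed-hereditary, if $A\in\mathbf{K}$ whenever $A$ is a $b$-closed subset, with the subspace topology, of some $X\in\mathbf{K}$; - said to have equalizers, if for any morphisms $f,g:X\to Y$ in $\mathbf{K}$, the equalizer $E_{f,g}=\{x\in X: f(x)=g(x)\}$, as a subspace of $X$, belongs to $\mathbf{K}$. *)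

(* Defs.v *)
From HB Require Import structures.
From mathcomp Require Import all_boot all_classical topology.

Set Implicit Arguments.
Unset Strict Implicit.
Unset Printing Implicit Defensive.

Local Open Scope classical_set_scope.

(* A full subcategory of Top_0 is a predicate K on topological spaces (all of
   whose members are T0); its morphisms are all the continuous mappings between
   members.  A subset A of X, used as a space, is coerced to set_type A, which
   carries the topology induced by X. *)

Definition homeomorphic (X Y : topologicalType) : Prop :=
  exists (f : X -> Y) (g : Y -> X),
    [/\ continuous f, continuous g, cancel f g & cancel g f].

Definition irreducible (X : topologicalType) (A : set X) : Prop :=
  A !=set0 /\
  forall F1 F2 : set X, closed F1 -> closed F2 ->
    A `<=` F1 `|` F2 -> A `<=` F1 \/ A `<=` F2.

Definition sober (X : topologicalType) : Prop :=
  kolmogorov_space X /\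
  forall A : set X, irreducible A -> closed A ->
    exists! x : X, A = closure [set x].

Definition b_base (X : topologicalType) : set (set X) :=
  [set B | exists U x, [/\ open U, U x & B = U `&` closure [set x]]].

(* A copy of X, to be equipped with the b-topology. *)
Definition b_space (X : topologicalType) : Type := X.

Section BTopology.
Variable X : topologicalType.

HB.instance Definition _ := Choice.on (b_space X).

Let b_base_cover : \bigcup_(B in @b_base X) (B : set (b_space X)) = setT.
Proof.
rewrite -subTset => x _; exists (setT `&` closure [set x]).
  by exists setT, x; split=> //; exact: openT.
by split=> //; apply: subset_closure.
Qed.

Let b_base_join (B C : set (b_space X)) (t : b_space X) :
  @b_base X B -> @b_base X C -> B t -> C t ->
  exists D : set (b_space X), [/\ @b_base X D, D t & D `<=` B `&` C].
Proof.
move=> [U [x [oU Ux ->]]] [V [y [oV Vy ->]]] [Ut xt] [Vt yt].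
have clt (z : X) : closure [set z] (t : X) ->
    closure [set (t : X)] `<=` closure [set z].
  move=> zt; rewrite [X in _ `<=` X]((closure_id _).1 (@closed_closure _ _)).
  by apply: closureS => _ ->.
exists ((U `&` V) `&` closure [set (t : X)]); split.
- by exists (U `&` V), t; split=> //; exact: openI.
- by split=> //; apply: subset_closure.
- by move=> z [[Uz Vz] tz]; split; split=> //; exact: clt tz.
Qed.

HB.instance Definition _ := @isBaseTopological.Build (b_space X)
  (set (b_space X)) (@b_base X) id b_base_cover b_base_join.

End BTopology.

Definition b_closed (X : topologicalType) (A : set X) : Prop :=
  closed (A : set (b_space X)).

Section Subcategories.
Variable K : topologicalType -> Prop.

Definition closed_under_homeomorphism : Prop :=
  forall X Y : topologicalType, K X -> homeomorphic X Y -> K Y.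

Definition reflective : Prop :=
  forall X : topologicalType, kolmogorov_space X ->
    exists (Xk : topologicalType) (mu : X -> Xk),
      [/\ K Xk, continuous mu &
          forall (Z : topologicalType) (f : X -> Z), K Z -> continuous f ->
            exists! g : Xk -> Z, continuous g /\ g \o mu = f].

Definition productive : Prop :=
  forall (I : Type) (X : I -> topologicalType),
    (forall i, K (X i)) -> K (prod_topology X).

Definition b_closed_hereditary : Prop :=
  forall (X : topologicalType) (A : set X), K X -> b_closed A -> K A.

Definition has_equalizers : Prop :=
  forall (X Y : topologicalType) (f g : X -> Y), K X -> K Y ->
    continuous f -> continuous g -> K [set x | f x = g x].

Definition contains_sober : Prop :=
  forall X : topologicalType, sober X -> K X.

Definition closed_under_intersections : Prop :=
  forall (X : topologicalType) (I : Type) (A : I -> set X), sober X ->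
    (forall i, K (A i)) -> K (\bigcap_i A i).

Definition closed_under_preimages : Prop :=
  forall (X Y : topologicalType) (f : X -> Y) (Y1 : set Y),
    sober X -> sober Y -> continuous f -> K Y1 -> K (f @^-1` Y1).

End Subcategories.

(* Main.v *)
(* Sierpinski powers replace sobrifications: x |-> {U open | x in U} embeds every
   T0 space X into the power S(X) of the Sierpinski space indexed by the subsets
   of X; S(X) is sober, and the image is b-closed when X is sober.

   The reflection of X is the smallest subspace of S(X) that belongs to K and
   contains the image of X.  A map X -> Z into K extends to S(X) -> S(Z), and the
   preimage of Z belongs to K; two extensions agree because equalizers of open
   sets of S(X) belong to K.  This only needs K to contain the Sierpinski powers
   and to be closed under intersections and preimages inside them, which follows
   from (2) as well as from (4).

   Conversely a reflective K is closed under limits, because an X whose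
   reflection map has a left inverse is homeomorphic to its reflection.  Since K
   has a non-T1 member, the Sierpinski space is a retract of it and hence in K,
   so that every b-closed subspace is an equalizer of maps into a Sierpinski
   power; in particular every sober space is in K. *)

From HB Require Import structures.
Require Import Defs.
From mathcomp Require Import all_boot all_classical topology.

Set Implicit Arguments.
Unset Strict Implicit.
Unset Printing Implicit Defensive.

Local Open Scope classical_set_scope.

(** * Pointwise criteria, subspaces, products and induced topologies *)

Lemma openP (X : topologicalType) (U : set X) :
  open U <-> forall x, U x -> exists V, [/\ open V, V x & V `<=` U].
Proof.
split=> [oU x Ux|H]; first by exists U; split.
rewrite openE => x /H[V [oV Vx VU]].
by rewrite /interior nbhsE; exists V.
Qed.

Lemma closure1P (X : topologicalType) (x y : X) :
  closure [set y] x <-> forall U, open U -> U x -> U y.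
Proof.
split=> [xy U oU Ux|H B].
  by have [|z [-> //]] := xy U; exact: open_nbhs_nbhs.
by rewrite nbhsE => -[V [oV Vx] VB]; exists y; split=> //; apply: VB; exact: H.
Qed.

Lemma kolmogorovP (X : topologicalType) : kolmogorov_space X <->
  forall x y : X, (forall U, open U -> U x <-> U y) -> x = y.
Proof.
split=> [T0 x y xy|H x y /eqP xy].
  apply: contrapT => /eqP /T0 [A].
  by rewrite !inE !nbhsE => -[[[U [oU Ux] UA]]|[[U [oU Ux] UA]]] []; apply: UA;
    apply/(xy U oU).
have : ~ forall U, open U -> U x <-> U y by move=> /H.
move=> /existsNP[U /not_implyP[oU]].
have [Ux|Ux] := pselect (U x); have [Uy|Uy] := pselect (U y).
- by case; split.
- by exists U; left; rewrite !inE; split=> //; exact: open_nbhs_nbhs.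
- by exists U; right; rewrite !inE; split=> //; exact: open_nbhs_nbhs.
- by case; split.
Qed.

(** A basic b-open set around [x] cut out by [U] and [closure [set y]] still contains the one cut
    out by [U] and [closure [set x]], so neighbourhoods can be centred at [x]. *)
Lemma b_closedP (X : topologicalType) (A : set X) : b_closed A <->
  forall x, ~ A x ->
    exists U, [/\ open U, U x & forall z, U z -> closure [set x] z -> ~ A z].
Proof.
rewrite /b_closed -openC; split.
  move=> [D DB DA] x Ax.
  have : (\bigcup_(B in D) B) x by rewrite DA.
  move=> [B DB0 Bx]; have [U [y [oU Uy BE]]] := DB _ DB0.
  move: (Bx); rewrite BE => -[Ux yx].
  exists U; split=> // z Uz xz Az.
  have : (\bigcup_(B in D) B) z.
    exists B => //; rewrite BE; split=> //.
    apply/closure1P => V oV Vz.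
    by apply: ((closure1P _ _).1 yx) => //; apply: ((closure1P _ _).1 xz).
  by rewrite DA => /(_ Az).
move=> H; exists [set B | b_base B /\ B `<=` ~` A]; first by move=> B [].
apply/seteqP; split=> [x [B [_ BA]] /BA //|x Ax].
have [U [oU Ux UA]] := H _ Ax.
exists (U `&` closure [set (x : X)]); last by split=> //; apply: subset_closure.
by split; [exists U, x|move=> z [Uz xz]; exact: UA xz].
Qed.

Lemma comp_continuous (X Y Z : topologicalType) (f : X -> Y) (g : Y -> Z) :
  continuous f -> continuous g -> continuous (g \o f).
Proof. by move=> fc gc x; apply: continuous_comp; [exact: fc|exact: gc]. Qed.

Lemma id_continuous (X : topologicalType) : continuous (@id X).
Proof. by move=> x. Qed.

Lemma subspace_val_continuous (X : topologicalType) (A : set X) :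
  continuous (val : A -> X).
Proof. exact: (@initial_continuous A X (@set_val X A)). Qed.

Lemma corestrict_continuous (X Y : topologicalType) (A : set Y) (f : X -> A) :
  continuous (val \o f) -> continuous f.
Proof. exact: (@continuous_comp_initial A X Y (@set_val Y A)). Qed.

Lemma subspace_openP (X : topologicalType) (A : set X) (U : set A) :
  open U <-> exists2 V : set X, open V & U = val @^-1` V.
Proof. by split=> -[V oV]; exists V. Qed.

Lemma proj_continuous (I : Type) (X : I -> topologicalType) (i : I) :
  continuous (fun p : prod_topology X => p i).
Proof.
move=> p; have /cvg_sup/(_ i) H : p --> p by exact: cvg_id.
move=> A pA; apply: H.
exact: (@initial_continuous _ _ (fun q : forall i, X i => q i) p A pA).
Qed.

Lemma tuple_continuous (T : topologicalType) (I : Type)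
    (X : I -> topologicalType) (f : T -> prod_topology X) :
  (forall i, continuous (fun t => f t i)) -> continuous f.
Proof.
move=> fc t; apply/cvg_sup => i.
exact: (@continuous_comp_initial _ T _ (fun q : forall i, X i => q i) f (fc i)).
Qed.

Lemma subspace_T0 (X : topologicalType) (A : set X) :
  kolmogorov_space X -> kolmogorov_space A.
Proof.
move=> /kolmogorovP T0; apply/kolmogorovP => x y xy.
apply: val_inj; apply: T0 => U oU; apply: (xy (val @^-1` U)).
by apply/subspace_openP; exists U.
Qed.

Lemma prod_T0 (I : Type) (X : I -> topologicalType) :
  (forall i, kolmogorov_space (X i)) -> kolmogorov_space (prod_topology X).
Proof.
move=> T0; apply/kolmogorovP => p q pq.
apply: functional_extensionality_dep => i.
have /kolmogorovP := T0 i; apply => U oU.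
apply: (pq (fun r : prod_topology X => U (r i))).
by have /continuousP := @proj_continuous I X i; exact.
Qed.

(** If an open [V] contains [f x] but not [g x], its preimage under [f] works: a point [z] of it in
    the closure of [x] with [f z = g z] would put [z], hence [x], in the preimage of [V] under
    [g]. *)
Lemma equalizer_b_closed (X Y : topologicalType) (f g : X -> Y) :
  kolmogorov_space Y -> continuous f -> continuous g ->
  b_closed [set x | f x = g x].
Proof.
move=> /kolmogorovP T0 /continuousP fc /continuousP gc; apply/b_closedP => x fgx.
have : ~ forall U, open U -> U (f x) <-> U (g x) by move=> /T0.
move=> /existsNP[V /not_implyP[oV]].
have [fx|fx] := pselect (V (f x)); have [gx|gx] := pselect (V (g x)).
- by case; split.
- move=> _; exists (f @^-1` V); split=> [|//|z fz /closure1P xz fgz]; first exact: fc.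
  by apply/gx/(xz (g @^-1` V)); [exact: gc|rewrite /preimage/= -fgz].
- move=> _; exists (g @^-1` V); split=> [|//|z gz /closure1P xz fgz]; first exact: gc.
  by apply/fx/(xz (f @^-1` V)); [exact: fc|rewrite /preimage/= fgz].
- by case; split.
Qed.

(** Points with the same image lie in the same open sets when every open set is a preimage under
    [f], so T0 makes [f] injective. *)
Lemma initial_range_inverse (X Y : topologicalType) (f : X -> Y) :
  kolmogorov_space X ->
  (forall U, open U -> exists2 V, open V & U = f @^-1` V) ->
  exists g : range f -> X, [/\ continuous g, forall y, f (g y) = val y &
    forall x y, val y = f x -> g y = x].
Proof.
move=> /kolmogorovP T0 fi.
have finj x y : f x = f y -> x = y.
  by move=> fxy; apply: T0 => U /fi[V _ ->]; rewrite /preimage/= fxy.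
have gP (y : range f) : {x | f x = val y}.
  by apply: cid; have /set_mem[x _ <-] := valP y; exists x.
exists (fun y => sval (gP y)); split=> [|y|x y yE].
- apply/continuousP => U /fi[V oV ->]; apply/subspace_openP; exists V => //.
  by apply/seteqP; split=> y /=; case: (gP y) => /= x ->.
- by case: (gP y).
- by case: (gP y) => /= z; rewrite yE => /finj.
Qed.

Lemma homeomorphic_range (X Y : topologicalType) (f : X -> Y) :
  kolmogorov_space X -> continuous f ->
  (forall U, open U -> exists2 V, open V & U = f @^-1` V) ->
  homeomorphic X (range f) /\ homeomorphic (range f) X.
Proof.
move=> T0 fc fi; have [g [gc fg gf]] := initial_range_inverse T0 fi.
pose h x : range f := SigSub (mem_set (imageT f x)).
have hc : continuous h by exact: corestrict_continuous.
have hK : cancel h g by move=> x; exact: gf.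
have gK : cancel g h by move=> y; apply: val_inj; exact: fg.
by split; [exists h, g|exists g, h]; split.
Qed.

Lemma homeomorphic_setT (X : topologicalType) : homeomorphic X [set: X].
Proof.
exists (fun x => SigSub (mem_set (I : [set: X] x))), val; split.
- by apply: corestrict_continuous; exact: (@id_continuous X).
- exact: subspace_val_continuous.
- by [].
- by move=> x; apply: val_inj.
Qed.

(** If [A] missed the intersection, the closed complements of [U] and [V] would cover it, hence one
    of them would. *)
Lemma irreducible_meetI (X : topologicalType) (A U V : set X) :
  irreducible A -> open U -> open V ->
  A `&` U !=set0 -> A `&` V !=set0 -> A `&` (U `&` V) !=set0.
Proof.
move=> [_ irrA] oU oV [x [Ax Ux]] [y [Ay Vy]]; apply: contrapT => AUV.
have [] := irrA _ _ (open_closedC oU) (open_closedC oV).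
- move=> z Az; have [Uz|] := pselect (U z); last by left.
  by right=> Vz; apply: AUV; exists z.
- by move=> /(_ x Ax).
- by move=> /(_ y Ay).
Qed.

(** * Powers of the Sierpinski space *)

(* [sier I] is the [I]-th power of the Sierpinski space, the point
   [p : I -> Prop] having coordinate 1 at [i] when [p i] holds. *)
Definition sier (I : Type) : Type := I -> Prop.

Section SierpinskiPower.
Variable I : Type.

HB.instance Definition _ := gen_eqMixin (sier I).
HB.instance Definition _ := gen_choiceMixin (sier I).

(** Basic open sets require finitely many coordinates to be 1 and never one to be 0; they generate
    the Scott topology of the powerset of [I]. *)
Definition all_on (s : seq I) (p : sier I) : Prop :=
  foldr (fun i P => p i /\ P) True s.

Definition sier_open : set (set (sier I)) :=
  [set W | forall p, W p -> exists2 s, all_on s p & all_on s `<=` W].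

Lemma all_on_cat s t p : all_on (s ++ t) p <-> all_on s p /\ all_on t p.
Proof. by elim: s => [|i s /= ->]; [split=> [|[]]|rewrite andA]. Qed.

Let sier_openT : sier_open setT.
Proof. by move=> p _; exists [::]. Qed.

Let sier_openI : setI_closed sier_open.
Proof.
move=> A B oA oB p [/oA[s sp sA] /oB[t tp tB]].
exists (s ++ t); first exact/all_on_cat.
by move=> q /all_on_cat[/sA ? /tB].
Qed.

Let sier_open_bigcup (J : Type) (f : J -> set (sier I)) :
  (forall j, sier_open (f j)) -> sier_open (\bigcup_j f j).
Proof.
by move=> fo p [j _ /fo[s sp sf]]; exists s => // q /sf; exists j.
Qed.

HB.instance Definition _ :=
  isOpenTopological.Build (sier I) sier_openT sier_openI sier_open_bigcup.

Lemma open_coord i : open [set p : sier I | p i].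
Proof. by move=> p pi; exists [:: i] => // q []. Qed.

Lemma open_all_on s : open (all_on s).
Proof. by move=> p; exists s. Qed.

Lemma sier_closure1 (p q : sier I) : closure [set q] p <-> p `<=` q.
Proof.
split=> [/closure1P pq i|pq]; first exact: (pq _ (@open_coord i)).
apply/closure1P => U oU /oU[s sp]; apply.
by elim: s sp => //= i s IH [/pq pi /IH].
Qed.

Lemma sier_T0 : kolmogorov_space (sier I).
Proof.
apply/kolmogorovP => p q pq; apply/seteqP.
by split=> i /(pq _ (@open_coord i)).
Qed.

Lemma sier_continuous (X : topologicalType) (f : X -> sier I) :
  (forall i, open [set x | f x i]) -> continuous f.
Proof.
move=> fo; apply/continuousP => W oW; apply/openP => x /oW[s sx sW].
exists (f @^-1` all_on s); split=> [|//|z /sW //].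
elim: s {sx sW} => [|i s IH]; first exact: openT.
exact: openI (fo i) IH.
Qed.

(** The generic point [q] is the union of all members of [A]. Each coordinate of [q] is attained in
    [A], and irreducibility attains finitely many at once, which puts everything below [q] in the
    closed set [A]. *)
Lemma sier_sober : sober (sier I).
Proof.
split=> [|A irrA clA]; first exact: sier_T0.
pose q : sier I := fun i => exists2 p, A p & p i.
have Aq p : A p -> p `<=` q by move=> Ap i pi; exists p.
exists q; split; last first.
  move=> r Ar; apply/seteqP; split=> i.
    by move=> [p]; rewrite Ar => /sier_closure1 pr /pr.
  by apply: Aq; rewrite Ar; apply: subset_closure.
apply/seteqP; split=> [p /Aq ?|p /sier_closure1 pq]; first exact/sier_closure1.
apply: clA => B; rewrite nbhsE => -[W [oW Wp] WB].
suff [r [Ar Wr]] : A `&` W !=set0 by exists r; split=> //; exact: WB.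
have [s sp sW] := oW _ Wp.
suff [r [Ar /sW Wr]] : A `&` all_on s !=set0 by exists r.
elim: s sp {sW} => [|i s IH] /=.
  by move=> _; case: irrA => -[r Ar] _; exists r.
move=> [/pq[r Ar ri] /IH]; apply: irreducible_meetI => //.
- exact: open_coord.
- exact: open_all_on.
- by exists r.
Qed.

End SierpinskiPower.

Definition open_nbhd (X : topologicalType) (x : X) : sier (set X) :=
  fun U => open U /\ U x.

Lemma open_nbhd_continuous (X : topologicalType) : continuous (@open_nbhd X).
Proof.
apply: sier_continuous => U; have [oU|oU] := pselect (open U).
  by rewrite (_ : [set _ | _] = U)//; apply/seteqP; split=> [x []|x].
rewrite (_ : [set _ | _] = set0); first exact: open0.
by rewrite -subset0 => x [].
Qed.

Lemma open_nbhd_initial (X : topologicalType) (U : set X) : open U ->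
  exists2 V, open V & U = @open_nbhd X @^-1` V.
Proof.
move=> oU; exists [set p | p U]; first exact: open_coord.
by apply/seteqP; split=> [x|x []].
Qed.

(** For [p] in the b-closure of the range, the closed set [A] of the points mapped below [p] is
    irreducible, and its generic point is mapped to [p]. *)
Lemma sober_range_b_closed (X : topologicalType) :
  sober X -> b_closed (range (@open_nbhd X)).
Proof.
move=> [_ soX]; apply/b_closedP => p; apply: contra_notP => H.
have {}H (W : set (sier (set X))) : open W -> W p ->
    exists2 x, W (open_nbhd x) & open_nbhd x `<=` p.
  move=> oW Wp; apply: contrapT => Wx; apply: H; exists W; split=> //.
  move=> q Wq /sier_closure1 qp [x _ xq]; apply: Wx.
  by exists x; rewrite xq.
pose A := [set x | open_nbhd x `<=` p].
have Acl : closed A.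
  rewrite (_ : A = @open_nbhd X @^-1` closure [set p]).
    move/continuous_closedP: (@open_nbhd_continuous X); apply.
    exact: closed_closure.
  by apply/seteqP; split=> x /sier_closure1.
have pA U : p U -> exists2 x, A x & open U /\ U x.
  by move=> /(H _ (@open_coord _ U))[x Ux Ax]; exists x.
have irrA : irreducible A.
  split=> [|F1 F2 F1c F2c AF].
    by have [x _ Ax] := H setT openT Logic.I; exists x.
  apply: contrapT => /not_orP[/existsNP[x /not_implyP[Ax F1x]]].
  move=> /existsNP[y /not_implyP[Ay F2y]].
  (* A point of [A] outside a closed set switches on the coordinate of [p] at its complement. A
     point of [A] whose image has both coordinates on lies outside [F1] and [F2]. *)
  have px : p (~` F1) by apply: Ax; split=> //; exact: closed_openC.
  have py : p (~` F2) by apply: Ay; split=> //; exact: closed_openC.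
  have [|//|z [[_ F1z] [_ F2z]] Az] := H ([set q | q (~` F1)] `&` [set q | q (~` F2)]).
    by apply: openI; exact: open_coord.
  by case: (AF z Az).
have [x [Ax _]] := soX _ irrA Acl.
exists x => //; apply/seteqP; split.
  by rewrite -[_ `<=` _]/(A x) Ax; apply: subset_closure.
move=> U /pA[y]; rewrite Ax => /closure1P yx [oU Uy].
by split=> //; exact: yx.
Qed.

(** * Subcategories with products and equalizers *)

Section ProductsAndEqualizers.
Context (K : topologicalType -> Prop)
  (K_T0 : forall X : topologicalType, K X -> kolmogorov_space X)
  (K_notT1 : exists X : topologicalType, K X /\ ~ accessible_space X)
  (K_homeo : closed_under_homeomorphism K)
  (K_prod : productive K) (K_eq : has_equalizers K).

(* Points [x <> y] of a non-T1 space with every open set around [x] containing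
   [y] span a Sierpinski subspace; an open set around [y] missing [x] makes it a
   retract, hence an equalizer. *)
Lemma sierpinski_mem : K (sier unit).
Proof.
have [Z [KZ]] := K_notT1.
move=> /existsNP[x /existsNP[y /not_implyP[/eqP xy /forallNP nA]]].
have {}nA U : open U -> U x -> U y.
  move=> oU Ux; apply: contrapT => Uy; apply: (nA U).
  by split; rewrite // inE.
have [U [oU Uy Ux]] : exists U, [/\ open U, U y & ~ U x].
  apply: contrapT => nU; apply: xy.
  have /kolmogorovP := K_T0 KZ; apply => U oU; split; first exact: nA.
  by move=> Uy; apply: contrapT => Ux; apply: nU; exists U.
pose r (z : Z) : sier unit := fun _ => U z.
pose s (p : sier unit) : Z := if pselect (p tt) then y else x.
have sy p : p tt -> s p = y by rewrite /s; case: pselect.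
have sx p : ~ p tt -> s p = x by rewrite /s; case: pselect.
have rc : continuous r by apply: sier_continuous.
have sc : continuous s.
  (* By [nA], an open [V] contains both [x] and [y], only [y], or neither. *)
  apply/continuousP => V oV; have [Vx|Vx] := pselect (V x).
    rewrite (_ : _ @^-1` _ = setT); first exact: openT.
    rewrite -subTset => p _ /=; have [pt|pt] := pselect (p tt).
      by rewrite /preimage/= sy//; exact: nA Vx.
    by rewrite /preimage/= sx.
  have [Vy|Vy] := pselect (V y).
    rewrite (_ : _ @^-1` _ = [set p | p tt]); first exact: open_coord.
    apply/seteqP; split=> p /=; last by rewrite /preimage/= => /sy ->.
    by apply: contraPP => /sx; rewrite /preimage/= => ->.
  rewrite (_ : _ @^-1` _ = set0); first exact: open0.
  rewrite -subset0 => p; have [pt|pt] := pselect (p tt).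
    by rewrite /preimage/= sy.
  by rewrite /preimage/= sx.
have rs : cancel s r.
  move=> p; apply: funext => -[]; apply: propext; rewrite /r.
  by have [pt|pt] := pselect (p tt); [rewrite sy|rewrite sx].
have KE := K_eq KZ KZ (@id_continuous Z) (comp_continuous rc sc).
apply: K_homeo KE _.
exists (fun e => r (val e)).
have sE p : [set z | id z = (s \o r) z] (s p) by rewrite /= rs.
exists (fun p => SigSub (mem_set (sE p))); split.
- exact: comp_continuous (@subspace_val_continuous _ _) rc.
- exact: corestrict_continuous.
- by move=> e; apply: val_inj => /=; have /set_mem/= <- := valP e.
- exact: rs.
Qed.

(** Up to homeomorphism this is a product of [I] copies of [sier unit]. *)
Lemma sier_mem (I : Type) : K (sier I).
Proof.
have KP := K_prod (fun _ : I => sierpinski_mem).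
apply: K_homeo KP _.
exists (fun (p : prod_topology _) i => p i tt), (fun p i _ => p i); split.
- apply: sier_continuous => i.
  have /continuousP := @proj_continuous I (fun=> sier unit) i.
  by move=> /(_ [set p | p tt] (@open_coord _ tt)).
- apply: tuple_continuous => i; apply: sier_continuous => _.
  exact: open_coord.
- by move=> p; apply: functional_extensionality_dep => i; apply: funext => -[].
- by [].
Qed.

(* For x outside A pick an open U_x around x with U_x `&` cl x disjoint from A:
   A is the equalizer of the maps with coordinates U_x and U_x `\` cl x. *)
Lemma b_closed_mem : b_closed_hereditary K.
Proof.
move=> X A KX /b_closedP bA.
have /choice[U UP] (x : X) : exists U : set X, ~ A x ->
    [/\ open U, U x & forall z, U z -> closure [set x] z -> ~ A z].
  have [Ax|/bA[U UP]] := pselect (A x); first by exists setT.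
  by exists U.
(* The conjunct [~ A x] zeroes the coordinates at points of [A], about which [UP] says nothing. *)
pose f (z : X) : sier X := fun x => ~ A x /\ U x z.
pose g (z : X) : sier X := fun x => ~ A x /\ (U x `&` ~` closure [set x]) z.
have andco (V : X -> set X) : (forall x, ~ A x -> open (V x)) ->
    continuous ((fun z x => ~ A x /\ V x z) : X -> sier X).
  move=> Vo; apply: sier_continuous => x; have [Ax|Ax] := pselect (A x).
    rewrite (_ : [set _ | _] = set0); first exact: open0.
    by rewrite -subset0 => z [].
  rewrite (_ : [set _ | _] = V x); first exact: Vo.
  by apply/seteqP; split=> z => [[]|].
rewrite (_ : A = [set z | f z = g z]).
  apply: K_eq => //; first exact: sier_mem.
    by apply: andco => x /UP[].
  apply: andco => x /UP[oU _ _]; apply: openI => //.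
  by apply: closed_openC; exact: closed_closure.
apply/seteqP; split=> z /=.
  move=> Az; apply: funext => x; apply: propext; split=> -[Ax].
    by move=> Uz; split=> //; split=> // xz; case: (UP x Ax) => _ _ /(_ z Uz xz).
  by case.
(* The coordinate [z] itself tells [f z] from [g z]. *)
move=> fg; apply: contrapT => Az; have [_ Uz _] := UP _ Az.
have : f z z by [].
by rewrite fg => -[_ [_]]; apply; apply: subset_closure.
Qed.

End ProductsAndEqualizers.

Lemma b_closed_has_equalizers (K : topologicalType -> Prop) :
  (forall X : topologicalType, K X -> kolmogorov_space X) ->
  b_closed_hereditary K -> has_equalizers K.
Proof.
move=> K_T0 Kb X Y f g KX KY fc gc; apply: Kb => //.
by apply: equalizer_b_closed => //; exact: K_T0.
Qed.

(** * Construction of reflections *)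

Section ReflectionInSierpinskiPowers.
Context (K : topologicalType -> Prop)
  (K_T0 : forall X : topologicalType, K X -> kolmogorov_space X)
  (K_homeo : closed_under_homeomorphism K)
  (K_sier : forall I : Type, K (sier I))
  (K_cap : forall (I : Type) (P : set (set (sier I))),
    P !=set0 -> (forall A, P A -> K A) -> K (\bigcap_(A in P) A))
  (K_pre : forall (I J : Type) (f : sier I -> sier J) (B : set (sier J)),
    continuous f -> K B -> K (f @^-1` B)).

(** The set is the preimage, under the map into [sier bool] with coordinates [U] and [V], of the
    diagonal, which is a copy of [sier unit]. *)
Lemma open_equalizer_mem (I : Type) (U V : set (sier I)) :
  open U -> open V -> K [set p | U p <-> V p].
Proof.
move=> oU oV; pose D := [set r : sier bool | r true <-> r false].
have KD : K D.
  apply: K_homeo (K_sier unit) _.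
  have DP (p : sier unit) : D (fun _ => p tt) by [].
  exists (fun p => SigSub (mem_set (DP p))), (fun r _ => val r true); split.
  - apply: corestrict_continuous; apply: sier_continuous => i.
    exact: (@open_coord _ tt).
  - apply: sier_continuous => _; apply/subspace_openP.
    by exists [set r | r true] => //; exact: open_coord.
  - by move=> p; apply: funext => -[].
  - move=> r; apply: val_inj; apply: funext => -[] //=; apply: propext.
    exact: set_mem (valP r).
pose q (p : sier I) : sier bool := fun b => if b then U p else V p.
by apply: (K_pre (f := q)) KD; apply: sier_continuous => -[].
Qed.

Lemma reflective_of_sier : reflective K.
Proof.
move=> X T0X.
pose P := [set A : set (sier (set X)) | K A /\ range (@open_nbhd X) `<=` A].
pose C := \bigcap_(A in P) A.
have KC : K C.
  apply: K_cap; last by move=> A [].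
  by exists setT; split=> //; exact: K_homeo (K_sier _) (@homeomorphic_setT _).
have CX x : C (open_nbhd x) by move=> A [_]; apply; exists x.
pose mu x : C := SigSub (mem_set (CX x)).
exists C, mu; split=> //.
  by apply: corestrict_continuous; exact: open_nbhd_continuous.
move=> Z f KZ fc; have T0Z := K_T0 KZ.
have [r [rc rP rE]] := initial_range_inverse T0Z (@open_nbhd_initial Z).
(* Pulling open sets of [Z] back along [f] makes sense for every family [p] of subsets, so it
   extends [f] to the whole power. *)
pose F (p : sier (set X)) : sier (set Z) := fun V => open V /\ p (f @^-1` V).
have Fc : continuous F.
  apply: sier_continuous => V; have [oV|oV] := pselect (open V).
    rewrite (_ : [set _ | _] = [set p | p (f @^-1` V)]); first exact: open_coord.
    by apply/seteqP; split=> [p []|].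
  rewrite (_ : [set _ | _] = set0); first exact: open0.
  by rewrite -subset0 => p [].
have FX x : F (open_nbhd x) = open_nbhd (f x).
  apply: funext => V; apply: propext; split=> [[oV [_ Vx]]//|[oV Vx]].
  by split=> //; split=> //; move/continuousP: fc; apply.
(* Minimality of [C]: the preimage under [F] of the copy of [Z] belongs to [P]. *)
have FC (c : C) : range (@open_nbhd Z) (F (val c)).
  have /set_mem := valP c; move/(_ (F @^-1` range (@open_nbhd Z))); apply.
  split.
    apply: K_pre => //; apply: K_homeo KZ _.
    by have [] := homeomorphic_range T0Z (@open_nbhd_continuous Z)
      (@open_nbhd_initial Z).
  by move=> _ [x _ <-]; exists (f x).
pose g (c : C) : Z := r (SigSub (mem_set (FC c))).
have gc : continuous g.
  apply: comp_continuous rc; apply: corestrict_continuous.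
  exact: comp_continuous (@subspace_val_continuous _ _) Fc.
have gmu : g \o mu = f by apply: funext => x; apply: rE; exact: FX.
exists g; split=> // h [hc hmu]; apply: funext => c.
(* The preimages of [V] under [g] and [h] are traces on [C] of open sets [V1] and [V2] of the power.
   These agree on the image of [X], so minimality of [C] applies to their equalizer. *)
have /kolmogorovP := T0Z; apply => V oV.
have [V1 oV1 V1E] := (subspace_openP _).1 ((continuousP _).1 gc V oV).
have [V2 oV2 V2E] := (subspace_openP _).1 ((continuousP _).1 hc V oV).
have gV (d : C) : V (g d) = V1 (val d) by rewrite -[LHS]/((g @^-1` V) d) V1E.
have hV (d : C) : V (h d) = V2 (val d) by rewrite -[LHS]/((h @^-1` V) d) V2E.
rewrite gV hV; have /set_mem := valP c.
move/(_ [set p | V1 p <-> V2 p]); apply; split; first exact: open_equalizer_mem.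
move=> _ [x _ <-] /=; have := gV (mu x); have := hV (mu x).
by rewrite -[h _]/((h \o mu) x) -[g _]/((g \o mu) x) hmu gmu => <- <-.
Qed.

End ReflectionInSierpinskiPowers.

Lemma reflective_of_sober (K : topologicalType -> Prop) :
  (forall X : topologicalType, K X -> kolmogorov_space X) ->
  contains_sober K -> closed_under_homeomorphism K ->
  closed_under_intersections K -> closed_under_preimages K -> reflective K.
Proof.
move=> K_T0 K_sober K_homeo K_int K_pre.
apply: reflective_of_sier => //.
- by move=> I; apply: K_sober; exact: sier_sober.
- move=> I P _ PK; rewrite bigcap_set_type; apply: K_int; first exact: sier_sober.
  by move=> A; apply: PK; exact: set_mem (valP A).
- by move=> I J f B fc KB; apply: K_pre => //; exact: sier_sober.
Qed.

(** Intersections and preimages are equalizers on products: an intersection consists of the constant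
    families in the product of its members, and a preimage is a pullback. *)
Lemma reflective_of_equalizers (K : topologicalType -> Prop) :
  (forall X : topologicalType, K X -> kolmogorov_space X) ->
  (exists X : topologicalType, K X /\ ~ accessible_space X) ->
  closed_under_homeomorphism K -> productive K -> has_equalizers K ->
  reflective K.
Proof.
move=> K_T0 K_notT1 K_homeo K_prod K_eq.
have K_sier I : K (sier I) by exact: sier_mem.
apply: reflective_of_sier => //.
- move=> I P [B0 PB0] PK.
  pose Y (B : P) : topologicalType := val B.
  have KW : K (prod_topology Y).
    by apply: K_prod => B; apply: PK; exact: set_mem (valP B).
  set W := prod_topology Y in KW.
  pose coord (p : W) (B : P) : sier I := val (p B : val B).
  (* Indexing by pairs of members puts all the required equalities into one pair of maps. *)
  pose u p : sier (P * P * I) := fun t => coord p t.1.1 t.2.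
  pose v p : sier (P * P * I) := fun t => coord p t.1.2 t.2.
  have coordc (B : P) i : open [set p : W | coord p B i].
    have /continuousP := comp_continuous (@proj_continuous P Y B)
      (@subspace_val_continuous _ (val B)).
    by move=> /(_ [set q | q i] (@open_coord _ i)).
  have uc : continuous u by apply: sier_continuous => -[[B B'] i]; exact: coordc.
  have vc : continuous v by apply: sier_continuous => -[[B B'] i]; exact: coordc.
  have KE := K_eq _ _ _ _ KW (K_sier _) uc vc.
  have uvP (e : [set p : W | u p = v p]) (B B' : P) : coord (val e) B = coord (val e) B'.
    apply: funext => i; have /set_mem/= := valP e.
    by move/(congr1 (fun w => w (B, B', i))).
  (* The common point of a compatible family is read off at [b0], which exists because [P] is
     nonempty. *)
  pose b0 : P := SigSub (mem_set PB0).
  have eC (e : [set p : W | u p = v p]) : (\bigcap_(A in P) A) (coord (val e) b0).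
    move=> A PA; rewrite (uvP e b0 (SigSub (mem_set PA))).
    exact: set_mem (valP (val e (SigSub (mem_set PA)) : A)).
  have CB (c : \bigcap_(A in P) A) (B : P) : (val B) (val c).
    by apply: (set_mem (valP c)); exact: set_mem (valP B).
  pose d c : W := fun B => SigSub (mem_set (CB c B)).
  have dE c : [set p : W | u p = v p] (d c) by [].
  apply: K_homeo KE _.
  exists (fun e => SigSub (mem_set (eC e))), (fun c => SigSub (mem_set (dE c))).
  split.
  + apply: corestrict_continuous; apply: sier_continuous => i.
    apply/subspace_openP; exists [set p : W | coord p b0 i] => //.
  + apply: corestrict_continuous; apply: tuple_continuous => B.
    apply: corestrict_continuous; exact: subspace_val_continuous.
  + move=> e; apply: val_inj; apply: functional_extensionality_dep => B.
    by apply: val_inj; exact: uvP.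
  + by move=> c; apply: val_inj.
- move=> I J f B fc KB.
  (* The binary product of [sier I] and [B], coded as a product over [bool]. *)
  pose Y (b : bool) : topologicalType := 
    if b then (sier I : topologicalType) else (B : topologicalType).
  have KW : K (prod_topology Y) by apply: K_prod => -[]; [exact: K_sier|exact: KB].
  set W := prod_topology Y in KW.
  pose u (p : W) : sier J := f (p true).
  pose v (p : W) : sier J := val (p false : B).
  have uc : continuous u := comp_continuous (@proj_continuous bool Y true) fc.
  have vc : continuous v := comp_continuous (@proj_continuous bool Y false)
    (@subspace_val_continuous _ B).
  have KE := K_eq _ _ _ _ KW (K_sier _) uc vc.
  have eP (e : [set p : W | u p = v p]) : (f @^-1` B) (val e true).
    have /set_mem/= uv := valP e; rewrite /preimage/= -[f _]/(u (val e)) uv.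
    exact: set_mem (valP (val e false : B)).
  have cB (c : f @^-1` B) : B (f (val c)) by exact: set_mem (valP c).
  pose d (c : f @^-1` B) : W := fun b => match b return Y b with
    | true => val c | false => SigSub (mem_set (cB c)) end.
  have dE c : [set p : W | u p = v p] (d c) by [].
  apply: K_homeo KE _.
  exists (fun e => SigSub (mem_set (eP e))), (fun c => SigSub (mem_set (dE c))).
  split.
  + apply: corestrict_continuous.
    exact: comp_continuous (@subspace_val_continuous _ _)
      (@proj_continuous bool Y true).
  + apply: corestrict_continuous; apply: tuple_continuous => -[].
      exact: subspace_val_continuous.
    apply: corestrict_continuous.
    exact: comp_continuous (@subspace_val_continuous _ _) fc.
  + move=> e; apply: val_inj; apply: functional_extensionality_dep => -[] //.
    by apply: val_inj; have /set_mem/= := valP e.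
  + by move=> c; apply: val_inj.
Qed.

(** * Limits in reflective subcategories *)

Section ClosureOfReflectiveSubcategories.
Context (K : topologicalType -> Prop)
  (K_T0 : forall X : topologicalType, K X -> kolmogorov_space X)
  (K_homeo : closed_under_homeomorphism K)
  (K_refl : reflective K).

(* Uniqueness of extensions makes [mu] an epimorphism towards K, so a left
   inverse of [mu] is automatically two-sided. *)
Lemma reflective_mem (X : topologicalType) : kolmogorov_space X ->
  (forall (T : topologicalType) (mu : X -> T), K T -> continuous mu ->
    (forall (Z : topologicalType) (f : X -> Z), K Z -> continuous f ->
      exists2 g : T -> Z, continuous g & g \o mu = f) ->
    (forall (Z : topologicalType) (g h : T -> Z), K Z ->
      continuous g -> continuous h -> g \o mu = h \o mu -> g = h) ->
    exists2 r : T -> X, continuous r & cancel mu r) ->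
  K X.
Proof.
move=> T0 rP; have [T [mu [KT muc mu_univ]]] := K_refl T0.
have epi (Z : topologicalType) (g h : T -> Z) : K Z ->
    continuous g -> continuous h -> g \o mu = h \o mu -> g = h.
  move=> KZ gc hc gh.
  have [k [_ kU]] := mu_univ Z (g \o mu) KZ (comp_continuous muc gc).
  by rewrite -(kU g)// -(kU h).
have [|//|r rc rK] := rP T mu KT muc.
  by move=> Z f KZ fc; have [g [[gc gmu] _]] := mu_univ Z f KZ fc; exists g.
apply: (K_homeo KT); exists r, mu; split=> //.
suff mur : mu \o r = id by move=> t; exact: (congr1 (@^~ t) mur).
apply: epi => //; [exact: comp_continuous rc muc|exact: id_continuous|].
by apply: funext => x /=; rewrite rK.
Qed.

(** The inclusion of [E] extends along [mu] to [h]; once [h] lands in [E], it is the left inverse of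
    [mu] sought. *)
Lemma reflective_subspace_mem (X : topologicalType) (E : set X) : K X ->
  (forall (T : topologicalType) (mu : E -> T) (h : T -> X),
    K T -> continuous mu -> continuous h -> h \o mu = val ->
    (forall (Z : topologicalType) (f : E -> Z), K Z -> continuous f ->
      exists2 g : T -> Z, continuous g & g \o mu = f) ->
    (forall (Z : topologicalType) (g h : T -> Z), K Z ->
      continuous g -> continuous h -> g \o mu = h \o mu -> g = h) ->
    forall t, E (h t)) ->
  K E.
Proof.
move=> KX hE; apply: reflective_mem; first exact: subspace_T0 (K_T0 KX).
move=> T mu KT muc ext epi.
have [h hc hmu] := ext X val KX (@subspace_val_continuous X E).
have {}hE := hE T mu h KT muc hc hmu ext epi.
exists (fun t => SigSub (mem_set (hE t))); first exact: corestrict_continuous.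
by move=> x; apply: val_inj; exact: (congr1 (@^~ x) hmu).
Qed.

(** The extensions of the projections along [mu] are the components of a left inverse. *)
Lemma reflective_productive : productive K.
Proof.
move=> I X KX; apply: reflective_mem.
  by apply: prod_T0 => i; exact: K_T0.
move=> T mu KT muc ext _.
have G i : {g : T -> X i | continuous g & g \o mu = (fun x => x i)}.
  by apply: cid2; apply: ext => //; exact: proj_continuous.
exists (fun t i => s2val (G i) t).
  by apply: tuple_continuous => i; case: (G i).
move=> x; apply: functional_extensionality_dep => i.
by case: (G i) => /= g _ gmu; exact: (congr1 (@^~ x) gmu).
Qed.

(** The maps [f \o h] and [g \o h] agree after [mu], hence everywhere. *)
Lemma reflective_has_equalizers : has_equalizers K.
Proof.
move=> X Y f g KX KY fc gc; apply: reflective_subspace_mem => //.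
move=> T mu h KT muc hc hmu _ epi t.
suff : f \o h = g \o h by move=> /(congr1 (@^~ t)).
apply: epi => //; [exact: comp_continuous hc fc|exact: comp_continuous hc gc|].
apply: funext => e /=; rewrite -[h _]/((h \o mu) e) hmu.
exact: set_mem (valP e).
Qed.

(** The inclusion into each [A i] extends to [g], and uniqueness of extensions into [X] identifies
    [h] with [g], so [h] lands in every [A i]. *)
Lemma reflective_intersections :
  contains_sober K -> closed_under_intersections K.
Proof.
move=> K_sober X I A soX KA; have KX := K_sober _ soX.
apply: reflective_subspace_mem => // T mu h KT muc hc hmu ext epi t i _.
have EA (e : \bigcap_i A i) : A i (val e) by exact: set_mem (valP e) i Logic.I.
have [|g gc gmu] := ext _ (fun e => SigSub (mem_set (EA e)) : A i) (KA i).
  by apply: corestrict_continuous; exact: subspace_val_continuous.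
suff -> : h = val \o g by exact: set_mem (valP (g t)).
apply: epi => //; first exact: comp_continuous gc (@subspace_val_continuous _ _).
by rewrite hmu -compA gmu.
Qed.

(** The restriction of [f] to a map into [B] extends to [g]; uniqueness of extensions into the sober
    space [Y] shows that [f \o h] factors through [g]. *)
Lemma reflective_preimages : contains_sober K -> closed_under_preimages K.
Proof.
move=> K_sober X Y f B soX soY fc KB.
apply: reflective_subspace_mem; first exact: K_sober.
move=> T mu h KT muc hc hmu ext epi t.
have EB (e : f @^-1` B) : B (f (val e)) by exact: set_mem (valP e).
have [|g gc gmu] := ext _ (fun e => SigSub (mem_set (EB e)) : B) KB.
  apply: corestrict_continuous.
  exact: comp_continuous (@subspace_val_continuous _ _) fc.
suff fh : f \o h = val \o g.
  by rewrite /preimage/= -[f _]/((f \o h) t) fh; exact: set_mem (valP (g t)).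
apply: epi; [exact: K_sober|exact: comp_continuous hc fc| |].
  exact: comp_continuous gc (@subspace_val_continuous _ _).
by rewrite -compA hmu -compA gmu.
Qed.

End ClosureOfReflectiveSubcategories.

(** The implications are proved cyclically. That (1) gives (4) comes first, because (1) to (2) uses
    it, and (2) to (3) returns to (1) in order to use it. *)
Theorem theorem0p1 (K : topologicalType -> Prop)
  (K_T0 : forall X : topologicalType, K X -> kolmogorov_space X)
  (K_notT1 : exists X : topologicalType, K X /\ ~ accessible_space X)
  (K_homeo : closed_under_homeomorphism K) :
  [<-> reflective K;
       [/\ contains_sober K, closed_under_homeomorphism K,
           closed_under_intersections K & closed_under_preimages K];
       productive K /\ b_closed_hereditary K;
       productive K /\ has_equalizers K].
Proof.
have refl4 : reflective K -> productive K /\ has_equalizers K.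
  by move=> K_refl; split;
    [exact: reflective_productive|exact: reflective_has_equalizers].
tfae.
- move=> K_refl; have [K_prod K_eq] := refl4 K_refl.
  have K_sober : contains_sober K.
    move=> X soX; have [T0 _] := soX.
    have KR : K (range (@open_nbhd X)).
      apply: b_closed_mem => //; first exact: sier_mem.
      exact: sober_range_b_closed.
    apply: K_homeo KR _.
    by have [] := homeomorphic_range T0 (@open_nbhd_continuous X)
      (@open_nbhd_initial X).
  by split=> //; [exact: reflective_intersections|exact: reflective_preimages].
- move=> [K_sober _ K_int K_pre].
  have /refl4[K_prod K_eq] : reflective K by exact: reflective_of_sober.
  by split=> //; exact: b_closed_mem.
- by move=> [K_prod Kb]; split=> //; exact: b_closed_has_equalizers.
- by move=> [K_prod K_eq]; exact: reflective_of_equalizers.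
Qed.
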